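(* Let $G$ be an infinite finitely generated group and let $N$ be a normal subgroup of $G$ such that $G/N$ is abelian. If $|G/N|>1$, then the Lie algebra $\mathrm{Der}$ of derivations of $\mathbb{C}[G]$ is graded with $G/N$ by the subspaces $\mathrm{Der}_k$, $k\in G/N$; that is, $$\mathrm{Der}=\bigoplus_{k\in G/N}\mathrm{Der}_k,\qquad [\mathrm{Der}_k,\mathrm{Der}_l]\subset \mathrm{Der}_{kl}\ \text{ for all } k,l\in G/N,$$ and (as the definition of a grading requires) $\mathrm{Der}_N\neq \mathrm{Der}$, where $N$ is regarded as the neutral element of $G/N$.
   Context: $\mathbb{C}[G]$ is the group algebra (finite formal sums). A derivation is a $\mathbb{C}$-linear operator $d:\mathbb{C}[G]\to\mathbb{C}[G]$ with $d(ab)=d(a)b+a\,d(b)$ for all $a,b\in\mathbb{C}[G]$; $\mathrm{Der}$ is the Lie algebra of all derivations with bracket $[d,\partial](x)=d(\partial(x))-\partial(d(x))$. Groupoid $\Gamma$: objects are elements of $G$; the set of arrows $\mathrm{Hom}$ is $G\times G$, where the arrow $(u,v)$ has source $v^{-1}u$ and target $uv^{-1}$. If the source of $(u_2,v_2)$ equals the target of $(u_1,v_1)$, the two arrows are composable and $(u_2,v_2)\circ(u_1,v_1)=(v_2u_1,v_2v_1)$. For a conjugacy class $[a]=\{xax^{-1}:x\in G\}$, $\Gamma_{[a]}$ is the subgroupoid with object set $[a]$ and arrows all $(u,v)$ with source and target in $[a]$ (an arrow has its source in $[a]$ if and only if it has its target in $[a]$). A character is a function $\chi:\mathrm{Hom}\to\mathbb{C}$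 such that $\chi(\phi\circ\psi)=\chi(\phi)+\chi(\psi)$ for all composable $\phi,\psi$, and such that for every $y\in G$ the set $\{x\in G:\chi(x,y)\neq0\}$ is finite. Its support is $\mathrm{supp}\,\chi=\{\phi\in\mathrm{Hom}:\chi(\phi)\ne0\}$. For each derivation $d$ there is a unique character $\chi^d$ (known fact) with $d(x)=\sum_{k\in G}\chi^d(k,x)\,k$ for all $x\in G$. For a coset $aN\in G/N$ put $\Gamma_{aN}=\bigcup_{k\in aN}\Gamma_{[k]}$ and $\mathrm{Der}_{aN}=\{d\in\mathrm{Der}:\mathrm{supp}\,\chi^d\subset\Gamma_{aN}\}$, where containment means that every arrow in the support is an arrow of $\Gamma_{aN}$. Definition: for an abelian group $A$ (written multiplicatively, neutral element $e$), a Lie algebra $\mathfrak{A}$ is graded with $A$ if $\mathfrak{A}=\bigoplus_{n\in A}\mathfrak{A}_n$ with $[\mathfrak{A}_n,\mathfrak{A}_l]\subset\mathfrak{A}_{nl}$ for all $n,l\in A$ and $\mathfrak{A}_e\neq\mathfrak{A}$ (trivial gradings are excluded). *)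

(* Defs.v *)
From HB Require Import structures.
From mathcomp Require Import all_boot all_order all_algebra finmap.
From mathcomp Require Import boolp classical_sets functions cardinality fsbigop.
From mathcomp Require Import reals complex.
From mathcomp Require Import monalg.

Set Implicit Arguments.
Unset Strict Implicit.
Unset Printing Implicit Defensive.

Import GRing.Theory.

Local Open Scope classical_set_scope.
Local Open Scope quotient_scope.
Local Open Scope ring_scope.

(* A subset of [G] is given by a boolean predicate; since excluded middle is
   available through [boolp], this covers every subgroup. *)
Definition finitely_generated (G : groupType) : Prop :=
  exists s : seq G, forall H : {pred G},
    group_closed H -> {subset s <= H} -> forall x, x \in H.

Record normalSubgroup (G : groupType) := NormalSubgroup {
  nsub_pred :> {pred G};
  nsub_group_closed : group_closed nsub_pred;
  nsub_conj : forall x y : G, x \in nsub_pred -> (x ^ y)%g \in nsub_pred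
}.

Section QuotientGroup.
Context {G : groupType} (N : normalSubgroup G).

Definition same_coset (x y : G) : bool := (x^-1 * y)%g \in (N : {pred G}).

Let N1 : (1%g : G) \in (N : {pred G}).
Proof. by case: (nsub_group_closed N). Qed.
Let NF (x y : G) : x \in (N : {pred G}) -> y \in (N : {pred G}) ->
  (x / y)%g \in (N : {pred G}).
Proof. by case: (nsub_group_closed N) => _; apply. Qed.
Let NV (x : G) : x \in (N : {pred G}) -> (x^-1)%g \in (N : {pred G}).
Proof. by move=> Nx; rewrite -[(x^-1)%g]mul1g NF. Qed.
Let NM (x y : G) : x \in (N : {pred G}) -> y \in (N : {pred G}) ->
  (x * y)%g \in (N : {pred G}).
Proof. by move=> Nx Ny; rewrite -[y]invgK NF ?NV. Qed.

Fact same_coset_refl : reflexive same_coset.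
Proof. by move=> x; rewrite /same_coset mulVg. Qed.

Fact same_coset_sym : symmetric same_coset.
Proof.
by move=> x y; apply/idP/idP => /NV; rewrite invgM invgK.
Qed.

Fact same_coset_trans : transitive same_coset.
Proof.
move=> y x z Nxy Nyz; rewrite /same_coset.
by rewrite -[z](mulVKg y) mulgA NM.
Qed.

Canonical same_coset_equiv :=
  EquivRel same_coset same_coset_refl same_coset_sym same_coset_trans.

Definition quotg := {eq_quot same_coset_equiv}.
HB.instance Definition _ := Choice.on quotg.
HB.instance Definition _ := EqQuotient.on quotg.

Definition cosetg (x : G) : quotg := \pi x.

Lemma cosetgP (x y : G) : reflect (cosetg x = cosetg y) (same_coset x y).
Proof. exact: eqmodP. Qed.

Lemma cosetgK (a : quotg) : cosetg (repr a) = a.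
Proof. exact: reprK. Qed.

Definition quotg_one : quotg := cosetg 1%g.
Definition quotg_mul (a b : quotg) : quotg := cosetg (repr a * repr b)%g.
Definition quotg_inv (a : quotg) : quotg := cosetg (repr a)^-1%g.

Fact quotg_mulE (x y : G) :
  quotg_mul (cosetg x) (cosetg y) = cosetg (x * y)%g.
Proof.
apply/cosetgP; set x' := repr _; set y' := repr _.
have /cosetgP Nx : cosetg x' = cosetg x by exact: cosetgK.
have /cosetgP Ny : cosetg y' = cosetg y by exact: cosetgK.
rewrite /same_coset.
have -> : ((x' * y')^-1 * (x * y))%g = ((x'^-1 * x) ^ y' * (y'^-1 * y))%g.
  by rewrite /conjg invgM !mulgA mulgK.
by apply: NM => //; apply: nsub_conj.
Qed.

Fact quotg_invE (x : G) : quotg_inv (cosetg x) = cosetg (x^-1)%g.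
Proof.
apply/cosetgP; rewrite /same_coset; set x' := repr _.
have /cosetgP Nx : cosetg x' = cosetg x by exact: cosetgK.
have -> : ((x'^-1)^-1 * x^-1)%g = ((x'^-1 * x)^-1 ^ x'^-1)%g.
  by rewrite /conjg invgM !invgK !mulgA mulgK.
by apply: nsub_conj; apply: NV.
Qed.

Fact quotg_mulA : associative quotg_mul.
Proof.
move=> a b c; rewrite -(cosetgK a) -(cosetgK b) -(cosetgK c).
set x := repr a; set y := repr b; set z := repr c.
by rewrite (quotg_mulE y) (quotg_mulE x y) !quotg_mulE mulgA.
Qed.

Fact quotg_mul1 : left_id quotg_one quotg_mul.
Proof.
by move=> a; rewrite -(cosetgK a) (quotg_mulE 1%g) mul1g.
Qed.

Fact quotg_mulr1 : right_id quotg_one quotg_mul.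
Proof.
by move=> a; rewrite -(cosetgK a) (quotg_mulE (repr a) 1%g) mulg1.
Qed.

Fact quotg_mulV : left_inverse quotg_one quotg_inv quotg_mul.
Proof.
move=> a; rewrite -(cosetgK a); set x := repr a.
by rewrite (quotg_invE x) (quotg_mulE _ x) mulVg.
Qed.

Fact quotg_mulrV : right_inverse quotg_one quotg_inv quotg_mul.
Proof.
move=> a; rewrite -(cosetgK a); set x := repr a.
by rewrite (quotg_invE x) (quotg_mulE x) mulgV.
Qed.

HB.instance Definition _ := isGroup.Build quotg
  quotg_mulA quotg_mul1 quotg_mulr1 quotg_mulV quotg_mulrV.

Lemma cosetg1 : cosetg 1 = 1%g.
Proof. by []. Qed.

Lemma cosetgM (x y : G) : cosetg (x * y) = (cosetg x * cosetg y)%g.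
Proof. by rewrite -quotg_mulE. Qed.

Definition coset_set (k : quotg) : set G := [set x | cosetg x = k].

Lemma coset_setE (a : G) : coset_set (cosetg a) =
  [set (a * n)%g | n in [set n | n \in (N : {pred G})]].
Proof.
apply/seteqP; split => [x /esym /cosetgP Nax|_ [n /= Nn <-]].
  by exists (a^-1 * x)%g => //; rewrite mulVKg.
by apply/esym/cosetgP; rewrite /same_coset mulKg.
Qed.

End QuotientGroup.

(* {malg K[G]} carries a ring structure in the library only when the monoid G
   has no units other than 1, so the convolution product over a group is put
   on the alias [groupAlg K G] of the K-module {malg K[G]}. *)
Definition groupAlg (K : comNzRingType) (G : groupType) := {malg K[G]}.

Section GroupAlgebra.
Context (K : comNzRingType) (G : groupType).
Implicit Types f g h : groupAlg K G.

HB.instance Definition _ := GRing.Lmodule.copy (groupAlg K G) {malg K[G]}.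

Definition galg_one : groupAlg K G := << 1%g >>.

Definition galg_mul f g : groupAlg K G :=
  \sum_(x <- msupp f) \sum_(y <- msupp g) << f@_x * g@_y *g (x * y)%g >>.

Fact galg_mulEw (d1 d2 : {fset G}) f g :
  (msupp f `<=` d1)%fset -> (msupp g `<=` d2)%fset ->
  galg_mul f g =
    \sum_(x <- d1) \sum_(y <- d2) << f@_x * g@_y *g (x * y)%g >>.
Proof.
move=> le1 le2; rewrite /galg_mul (big_fset_incl _ le1) /=.
  apply/eq_bigr=> x _; apply/big_fset_incl => // k _ /mcoeff_outdom ->.
  by rewrite mulr0 monalgU0.
move=> k _ /mcoeff_outdom fk.
by rewrite big1 => // y _; rewrite fk mul0r monalgU0.
Qed.

Fact galg_mulDl : left_distributive galg_mul +%R.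
Proof.
move=> f g h; set d := (msupp f `|` msupp g)%fset.
rewrite (@galg_mulEw d (msupp h) (f + g)) ?msuppD_le //.
rewrite (@galg_mulEw d (msupp h) f) ?fsubsetUl //.
rewrite (@galg_mulEw d (msupp h) g) ?fsubsetUr //.
rewrite -big_split /=; apply/eq_bigr=> x _.
rewrite -big_split /=; apply/eq_bigr=> y _.
by rewrite mcoeffD mulrDl monalgUD.
Qed.

Fact galg_mulDr : right_distributive galg_mul +%R.
Proof.
move=> h f g; set d := (msupp f `|` msupp g)%fset.
rewrite (@galg_mulEw (msupp h) d h (f + g)) ?msuppD_le //.
rewrite (@galg_mulEw (msupp h) d h f) ?fsubsetUl //.
rewrite (@galg_mulEw (msupp h) d h g) ?fsubsetUr //.
rewrite -big_split /=; apply/eq_bigr=> x _.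
rewrite -big_split /=; apply/eq_bigr=> y _.
by rewrite mcoeffD mulrDr monalgUD.
Qed.

Fact galg_mul0g f : galg_mul 0 f = 0.
Proof. by rewrite /galg_mul msupp0 big_seq_fset0. Qed.
Fact galg_mulg0 f : galg_mul f 0 = 0.
Proof.
by rewrite /galg_mul msupp0; under eq_bigr do rewrite big_seq_fset0; rewrite big1.
Qed.

Fact galg_mulUU (a b : K) (x y : G) :
  galg_mul << a *g x >> << b *g y >> = << a * b *g (x * y)%g >>.
Proof.
rewrite (@galg_mulEw [fset x]%fset [fset y]%fset) ?msuppU_le //.
by rewrite !big_seq_fset1 !mcoeffUU.
Qed.

Fact galg_mul_suml I (r : seq I) (F : I -> groupAlg K G) g :
  galg_mul (\sum_(i <- r) F i) g = \sum_(i <- r) galg_mul (F i) g.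
Proof.
exact: (big_morph (galg_mul^~ g) (fun f h => galg_mulDl f h g) (galg_mul0g g)).
Qed.

Fact galg_mul_sumr I (r : seq I) (F : I -> groupAlg K G) g :
  galg_mul g (\sum_(i <- r) F i) = \sum_(i <- r) galg_mul g (F i).
Proof.
exact: (big_morph (galg_mul g) (galg_mulDr g) (galg_mulg0 g)).
Qed.

Fact galg_mulA : associative galg_mul.
Proof.
move=> f g h; rewrite [f]monalgE !(galg_mul_suml (msupp f)).
apply: eq_bigr => x _.
rewrite [g]monalgE (galg_mul_suml (msupp g)) !(galg_mul_sumr (msupp g)).
rewrite (galg_mul_suml (msupp g)); apply: eq_bigr => y _.
rewrite [h]monalgE !(galg_mul_sumr (msupp h)).
by apply: eq_bigr => z _; rewrite !galg_mulUU mulrA mulgA.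
Qed.

Fact galg_mul1 : left_id galg_one galg_mul.
Proof.
move=> f; rewrite {1}[f]monalgE galg_mul_sumr [RHS]monalgE.
by apply: eq_bigr => x _; rewrite galg_mulUU mul1r mul1g.
Qed.

Fact galg_mulr1 : right_id galg_one galg_mul.
Proof.
move=> f; rewrite {1}[f]monalgE galg_mul_suml [RHS]monalgE.
by apply: eq_bigr => x _; rewrite galg_mulUU mulr1 mulg1.
Qed.

Fact galg_one_neq0 : galg_one != 0.
Proof. by rewrite monalgU_eq0 oner_eq0. Qed.

HB.instance Definition _ := GRing.Zmodule_isNzRing.Build (groupAlg K G)
  galg_mulA galg_mul1 galg_mulr1 galg_mulDl galg_mulDr galg_one_neq0.

Fact galg_scaleU (a b : K) (x : G) :
  a *: (<< b *g x >> : groupAlg K G) = << a * b *g x >>.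
Proof. by apply/malgP => y; rewrite mcoeffZ !mcoeffU mulrnAr. Qed.

Fact galg_scaleAl (a : K) (f g : groupAlg K G) : a *: (f * g) = (a *: f) * g.
Proof.
rewrite [RHS](@galg_mulEw (msupp f) (msupp g)) ?msuppZ_le //.
rewrite scaler_sumr; apply: eq_bigr => x _.
rewrite scaler_sumr; apply: eq_bigr => y _.
by rewrite galg_scaleU mcoeffZ mulrA.
Qed.

Fact galg_scaleAr (a : K) (f g : groupAlg K G) : a *: (f * g) = f * (a *: g).
Proof.
rewrite [RHS](@galg_mulEw (msupp f) (msupp g)) ?msuppZ_le //.
rewrite scaler_sumr; apply: eq_bigr => x _.
rewrite scaler_sumr; apply: eq_bigr => y _.
by rewrite galg_scaleU mcoeffZ mulrCA.
Qed.

HB.instance Definition _ :=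
  GRing.Lmodule_isLalgebra.Build K (groupAlg K G) galg_scaleAl.
HB.instance Definition _ :=
  GRing.Lalgebra_isAlgebra.Build K (groupAlg K G) galg_scaleAr.

End GroupAlgebra.

HB.mixin Record Lmodule_isLieAlgebra (K : comNzRingType) L
    of GRing.Lmodule K L := {
  lie : L -> L -> L;
  lie_linearl : forall y, linear (lie^~ y);
  lie_linearr : forall x, linear (lie x);
  lie_alternating : forall x, lie x x = 0;
  lie_jacobi : forall x y z,
    lie x (lie y z) + lie y (lie z x) + lie z (lie x y) = 0
}.

#[short(type="lieAlgType")]
HB.structure Definition LieAlgebra (K : comNzRingType) :=
  { L of Lmodule_isLieAlgebra K L & GRing.Lmodule K L }.

Definition is_subspace (K : comNzRingType) (V : lmodType K) (S : set V) : Prop :=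
  S 0 /\ forall (a : K) (u v : V), S u -> S v -> S (a *: u + v).

(* Internal direct sum: each vector is uniquely a finitely supported sum of
   components; for subspaces this is spanning plus independence. *)
Definition is_direct_sum (K : comNzRingType) (V : lmodType K) (I : choiceType)
    (F : I -> set V) : Prop :=
  forall x : V, exists! f : {fsfun I -> V with 0},
    (forall i, F i (f i)) /\ x = \sum_(i <- finsupp f) f i.

(* The last clause excludes trivial gradings, those with [F 1] everything. *)
Definition graded (K : comNzRingType) (L : lieAlgType K) (A : groupType)
    (F : A -> set L) : Prop :=
  [/\ commutative (@monoid.mul A),
      forall n, is_subspace (F n),
      is_direct_sum F,
      forall n l x y, F n x -> F l y -> F (n * l)%g (lie x y)
    & F 1%g <> [set: L]].

Section Derivations.
Context (K : comNzRingType) (A : algType K).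

Definition derivation (d : A -> A) : Prop :=
  linear d /\ forall a b, d (a * b) = d a * b + a * d b.

Definition derivation_pred : {pred A -> A} := fun d => `[< derivation d >].

Fact derivation_submod_closed : submod_closed derivation_pred.
Proof.
split=> [|a d e /asboolP [dl dM] /asboolP [el eM]]; apply/asboolP; split.
- by move=> a x y; rewrite scaler0 addr0.
- by move=> x y; rewrite mul0r mulr0 addr0.
- move=> b x y; rewrite /= !fctE dl el !scalerDr !scalerA [a * b]mulrC.
  by rewrite addrACA.
- move=> x y; rewrite /= !fctE dM eM !scalerDr mulrDl mulrDr.
  by rewrite -!scalerAl -!scalerAr addrACA.
Qed.

HB.instance Definition _ :=
  GRing.isSubmodClosed.Build K (A -> A) derivation_pred derivation_submod_closed.

Record Der := MkDer { Der_fun :> A -> A; _ : Der_fun \in derivation_pred }.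

HB.instance Definition _ := [isSub for Der_fun].
HB.instance Definition _ := [Choice of Der by <:].
HB.instance Definition _ := [SubChoice_isSubLmodule of Der by <:].

Lemma DerP (d : Der) : derivation d.
Proof. by case: d => d /= /asboolP. Qed.

Fact Der_lie_subproof (d e : Der) :
  (fun x => d (e x) - e (d x)) \in derivation_pred.
Proof.
have [[dl dM] [el eM]] := (DerP d, DerP e).
have dD u v : d (u + v) = d u + d v by have := dl 1 u v; rewrite !scale1r.
have eD u v : e (u + v) = e u + e v by have := el 1 u v; rewrite !scale1r.
apply/asboolP; split=> [a x y|x y].
  by rewrite el dl dl el scalerBr opprD addrACA.
rewrite dM eM dD eD !dM !eM mulrBl mulrBr.
rewrite [d x * e y + _]addrC addrACA [e x * d y + x * e _]addrC.
rewrite [X in _ - X]addrACA [X in _ - X]addrC.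
by rewrite [d x * e y + _]addrC addrKA opprD addrACA.
Qed.

Definition Der_lie (d e : Der) : Der := MkDer (Der_lie_subproof d e).

Lemma Der_lieE (d e : Der) x : Der_lie d e x = d (e x) - e (d x).
Proof. by []. Qed.

Lemma Der_ext (d e : Der) : d =1 e -> d = e.
Proof. by move=> de; apply: val_inj; apply: funext. Qed.

Let DerD (d e : Der) x : (d + e) x = d x + e x. Proof. by []. Qed.
Let DerZ (a : K) (d : Der) x : (a *: d) x = a *: d x. Proof. by []. Qed.
Let Der0 x : (0 : Der) x = 0. Proof. by []. Qed.
Let Der_linear (d : Der) (a : K) x y : d (a *: x + y) = a *: d x + d y.
Proof. by case: (DerP d) => dl _; rewrite dl. Qed.
Let Der_sub (d : Der) x y : d (x - y) = d x - d y.
Proof. by rewrite addrC -scaleN1r Der_linear scaleN1r addrC. Qed.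

Fact Der_lie_linearl e : linear (Der_lie^~ e).
Proof.
move=> a d1 d2; apply: Der_ext => x.
by rewrite !(DerD, DerZ, Der_lieE) Der_linear scalerBr opprD addrACA.
Qed.

Fact Der_lie_linearr d : linear (Der_lie d).
Proof.
move=> a e1 e2; apply: Der_ext => x.
by rewrite !(DerD, DerZ, Der_lieE) Der_linear scalerBr opprD addrACA.
Qed.

Fact Der_lie_alternating d : Der_lie d d = 0.
Proof. by apply: Der_ext => x; rewrite Der_lieE subrr. Qed.

Fact Der_lie_jacobi d e f :
  Der_lie d (Der_lie e f) + Der_lie e (Der_lie f d) + Der_lie f (Der_lie d e) = 0.
Proof.
apply: Der_ext => x; rewrite !(DerD, Der_lieE) !Der_sub Der0 !opprB.
rewrite [X in _ + X + _]addrC [X in X + _]addrACA !subrKA.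
by rewrite addrACA !subrKA subrr.
Qed.

HB.instance Definition _ := Lmodule_isLieAlgebra.Build K Der
  Der_lie_linearl Der_lie_linearr Der_lie_alternating Der_lie_jacobi.

End Derivations.

Section CharacterGroupoid.
Context (G : groupType).

(* The groupoid with object set [G] whose arrow [(u, v)] goes from [v^-1 u] to
   [u v^-1]; [arrow_comp phi psi] is [phi] after [psi] and is meaningful only
   when [composable phi psi]. *)
Definition arrow := (G * G)%type.

Definition source (phi : arrow) : G := (phi.2^-1 * phi.1)%g.
Definition target (phi : arrow) : G := (phi.1 * phi.2^-1)%g.

Definition composable (phi psi : arrow) : Prop := source phi = target psi.
Definition arrow_comp (phi psi : arrow) : arrow :=
  (phi.2 * psi.1, phi.2 * psi.2)%g.

Definition conj_class (a : G) : set G := range (fun x : G => x * a * x^-1)%g.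

(* Only the arrows of a subgroupoid are recorded. *)
Definition class_arrows (a : G) : set arrow :=
  [set phi | conj_class a (source phi) /\ conj_class a (target phi)].

Definition coset_arrows (N : normalSubgroup G) (k : quotg N) : set arrow :=
  \bigcup_(a in coset_set k) class_arrows a.

Definition is_character (K : comNzRingType) (chi : arrow -> K) : Prop :=
  (forall phi psi, composable phi psi ->
     chi (arrow_comp phi psi) = chi phi + chi psi) /\
  (forall y, finite_set [set x | chi (x, y) != 0]).

Definition char_support (K : comNzRingType) (chi : arrow -> K) : set arrow :=
  [set phi | chi phi != 0].

End CharacterGroupoid.

Section CharacterOfDerivation.
Context (K : comNzRingType) (G : groupType).
Implicit Types (d : Der (groupAlg K G)) (chi : arrow G -> K).

Definition galg_elt (x : G) : groupAlg K G := << x >>.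

Definition represents chi d : Prop :=
  forall x, d (galg_elt x) = \sum_(k \in [set: G]) chi (k, x) *: galg_elt k.

(* The character attached to [d]; existence and uniqueness are [char_ofP] and
   [represents_unique], so the default value of [xget] is never used. *)
Definition char_of d : arrow G -> K :=
  xget (fun=> 0) [set chi | is_character chi /\ represents chi d].

Lemma galg_eltM (x y : G) : galg_elt (x * y) = galg_elt x * galg_elt y.
Proof. by rewrite [RHS]galg_mulUU mulr1. Qed.

Lemma mcoeff_mul_elt (f : groupAlg K G) (y k : G) :
  (f * galg_elt y)@_k = f@_(k * y^-1)%g.
Proof.
rewrite [f * _](@galg_mulEw _ _ (msupp f) [fset y]%fset) ?msuppU_le //.
rewrite [f in RHS]monalgE !raddf_sum; apply: eq_bigr => x _ /=.
rewrite big_seq_fset1 mcoeffUU mulr1 !mcoeffU; congr (_ *+ nat_of_bool _).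
by apply/eqP/eqP => [<-|->]; rewrite ?mulgK ?mulgKV ?mulgVK.
Qed.

Lemma mcoeff_elt_mul (f : groupAlg K G) (y k : G) :
  (galg_elt y * f)@_k = f@_(y^-1 * k)%g.
Proof.
rewrite [_ * f](@galg_mulEw _ _ [fset y]%fset (msupp f)) ?msuppU_le //.
rewrite big_seq_fset1 mcoeffUU [f in RHS]monalgE !raddf_sum.
apply: eq_bigr => x _ /=.
rewrite mul1r !mcoeffU; congr (_ *+ nat_of_bool _).
by apply/eqP/eqP => [<-|->]; rewrite ?mulKg ?mulVKg.
Qed.

Lemma represents_unique chi d : is_character chi -> represents chi d ->
  chi = fun phi => (d (galg_elt phi.2))@_(phi.1).
Proof.
move=> [_ chif] chid; apply/funext => -[k x] /=; rewrite chid.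
have /finite_fsetP[X Xx] := chif x.
have chi0 y : y \notin X -> chi (y, x) = 0.
  move=> yX; apply: contraNeq yX => cy.
  by have : [set` X] y by rewrite -Xx.
rewrite (fsbigE X) ?fset_uniq //; last first.
  by move=> y _ /chi0 ->; rewrite scale0r.
rewrite (eq_bigl xpredT) => [|y]; last by rewrite in_setT.
rewrite raddf_sum /=; under eq_bigr do rewrite mcoeffZ mcoeffU.
have [kX|kX] := boolP (k \in X); last first.
  rewrite big1_seq ?chi0 // => y /= yX.
  by case: eqP yX kX => [-> ->|]; rewrite ?mulr0.
rewrite (big_fsetD1 k) //= eqxx mulr1 big1_fset ?addr0 // => y.
by rewrite in_fsetD1 => /andP[/negPf-> _] _; rewrite mulr0.
Qed.

Lemma represents_coef d :
  let chi phi := (d (galg_elt phi.2))@_(phi.1) in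
  is_character chi /\ represents chi d.
Proof.
move=> chi; have [dl dM] := DerP d; split; first split.
- move=> [u2 v2] [u1 v1]; rewrite /composable /source /target /= => uv.
  rewrite /chi /= galg_eltM dM mcoeffD mcoeff_mul_elt mcoeff_elt_mul.
  by rewrite mulKg -mulgA -uv mulVKg.
- move=> y; have := finite_fset (msupp (d (galg_elt y))).
  by apply: sub_finite_set => x /=; rewrite /chi /= mcoeff_neq0.
- move=> x; rewrite (fsbigE (msupp (d (galg_elt x)))) ?fset_uniq //; last first.
    by move=> y _ yd; rewrite /chi /= mcoeff_outdom // scale0r.
  rewrite (eq_bigl xpredT) => [|y]; last by rewrite in_setT.
  rewrite {1}[d _]monalgE; apply: eq_bigr => y _.
  by rewrite [RHS]galg_scaleU mulr1.
Qed.

Lemma char_ofP d : is_character (char_of d) /\ represents (char_of d) d.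
Proof.
exact: (@xgetI _ (fun=> 0) [set chi | is_character chi /\ represents chi d] _
  (represents_coef d)).
Qed.

Lemma char_ofE d k x : char_of d (k, x) = (d (galg_elt x))@_k.
Proof. by have [/represents_unique H /H ->] := char_ofP d. Qed.

Definition Der_coset (N : normalSubgroup G) (k : quotg N) :
    set (Der (groupAlg K G)) :=
  [set d | char_support (char_of d) `<=` coset_arrows k].

End CharacterOfDerivation.

(* Main.v *)
Require Import Defs.
From mathcomp Require Import all_boot all_order all_algebra finmap.
From mathcomp Require Import boolp classical_sets cardinality.
From mathcomp Require Import reals complex ring.
From mathcomp Require Import monalg.

(** A derivation [d] is the same thing as its character [chi], and the character
    splits arrow by arrow.  Since [G/N] is abelian, the source and the target
    of an arrow lie in the same coset of [N], and all the arrows occurring in a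
    composition share that coset.  Cutting [chi] down to the arrows of coset
    [k] therefore gives again a character, hence a derivation, the component of
    [d] of degree [k] ([restrict_character], [derivation_of_character]).
    Components of distinct degrees are characters with disjoint supports, so
    the decomposition is unique.

    Only finitely many components are nonzero.  This is where generators enter:
    the finitely many elements [d s], for [s] a generator, have finite supports,
    so the arrows [(u, s)] that [chi] does not kill meet finitely many cosets;
    in any other coset [chi] vanishes over the generators, hence everywhere
    ([char_eq0_gen]).

    For the bracket, a nonzero coefficient of [d (e x)] at [u] passes through
    some [v]: the arrows [(u, v)] and [(v, x)] have cosets [k] and [l], and
    [(u, x)] then has coset [k l].

    Finally [Der_N] is not everything.  If some [a] outside [N] is not central,
    the character of the inner derivation of [a] is nonzero at some arrow
    ending at [a].  Otherwise everything outside [N] is central, which forces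
    [G] to be abelian; being infinite and finitely generated, [G] then has an element of infinite order
    and a nonzero additive function [h] to the scalars
    ([nonzero_additive_of_infinite_order]), and [x |-> h x * (z x)] with [z]
    outside [N] is a nonzero derivation of degree [z N]. *)

Set Implicit Arguments.
Unset Strict Implicit.
Unset Printing Implicit Defensive.

Import GRing.Theory Num.Theory.

Local Open Scope classical_set_scope.
Local Open Scope ring_scope.

Definition generates (G : groupType) (s : seq G) : Prop :=
  forall H : {pred G}, group_closed H -> {subset s <= H} -> forall x, x \in H.

(** * Derivations and characters *)

Section ArrowComposition.
Context (G : groupType).
Implicit Types (phi psi : arrow G).

Lemma source_comp phi psi : source (arrow_comp phi psi) = source psi.
Proof. by rewrite /source /= invgM -mulgA mulKg. Qed.

Lemma target_comp phi psi : composable phi psi ->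
  target (arrow_comp phi psi) = target phi.
Proof.
rewrite /composable /source /target /= => pp.
by rewrite invgM !mulgA -[(_ * psi.1 * _)%g]mulgA -pp mulVKg.
Qed.

End ArrowComposition.

Section CharactersAndDerivations.
Context (K : comNzRingType) (G : groupType).
Implicit Types (f g : groupAlg K G) (d e : Der (groupAlg K G)).
Implicit Types (chi : arrow G -> K) (phi psi : arrow G).

Lemma galg_linear_ind (P : groupAlg K G -> Prop) :
  P 0 -> (forall a x f, P f -> P (a *: galg_elt K x + f)) -> forall f, P f.
Proof.
move=> P0 PD f; rewrite [f]monalgE; apply: big_rec => // x g _ Pg.
by rewrite -[f@_x]mulr1 -galg_scaleU; apply: PD.
Qed.

Lemma Der_linearP d a f g : d (a *: f + g) = a *: d f + d g.
Proof. by case: (DerP d) => dl _; rewrite dl. Qed.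

Lemma Der0E d : d 0 = 0.
Proof.
by have := Der_linearP d (-1) 0 0; rewrite scaler0 addr0 scaleN1r addNr.
Qed.

Lemma char_of_inj d e : char_of d =1 char_of e -> d = e.
Proof.
move=> de; apply: Der_ext; elim/galg_linear_ind => [|a x f IHf].
  by rewrite !Der0E.
suff deU : d (galg_elt K x) = e (galg_elt K x) by rewrite !Der_linearP IHf deU.
by apply/malgP => k; rewrite -!char_ofE.
Qed.

Lemma char_of_linear a d e phi :
  char_of (a *: d + e) phi = a * char_of d phi + char_of e phi.
Proof.
by case: phi => k x; rewrite !char_ofE /= mcoeffD mcoeffZ.
Qed.

Lemma char_of0 phi : char_of (0 : Der (groupAlg K G)) phi = 0.
Proof. by case: phi => k x; rewrite char_ofE /= mcoeff0. Qed.

Lemma char_of_sum I (r : seq I) (F : I -> Der (groupAlg K G)) phi :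
  char_of (\sum_(i <- r) F i) phi = \sum_(i <- r) char_of (F i) phi.
Proof.
elim/big_rec2: _ => [|i a d _ <-]; first exact: char_of0.
by rewrite -[F i]scale1r char_of_linear scale1r mul1r.
Qed.

(** The values [chi (_, x)] have finite support, so they are the coefficients of
    an element [F x], and [D] below is the linear extension of [F].  Additivity
    of [chi] on the composition of [(k / y, x)] with [(x^-1 k, y)], which is
    [(k, x y)], is the Leibniz rule at [x], [y] read off at the coefficient
    [k]. *)
Lemma derivation_of_character chi :
  is_character chi -> exists d : Der (groupAlg K G), char_of d = chi.
Proof.
move=> [chiM chif].
have [F FE] : exists F : G -> groupAlg K G, forall x k, (F x)@_k = chi (k, x).
  have H x : exists f : groupAlg K G, forall k, f@_k = chi (k, x).
    have /finite_fsetP[X Xx] := chif x.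
    exists [malg k in X => chi (k, x)] => k; rewrite mcoeffE.
    case: ifPn => // kX; apply/esym; apply: contraNeq kX => ck.
    by have : [set` X] k by rewrite -Xx.
  by have [F FE] := choice H; exists F.
pose D f : groupAlg K G := \sum_(x <- msupp f) f@_x *: F x.
have DE (X : {fset G}) f : (msupp f `<=` X)%fset -> D f = \sum_(x <- X) f@_x *: F x.
  move=> fX; rewrite /D (big_fset_incl _ fX) // => x _ /mcoeff_outdom ->.
  by rewrite scale0r.
have Dlin : linear D.
  move=> a f g; set X := (msupp f `|` msupp g)%fset.
  rewrite (DE X) ?(DE X f) ?(DE X g) ?fsubsetUl ?fsubsetUr //; last first.
    by rewrite (fsubset_trans (msuppD_le _ _)) // fsetSU // msuppZ_le.
  rewrite scaler_sumr -big_split /=; apply: eq_bigr => x _.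
  by rewrite mcoeffD mcoeffZ scalerDl scalerA.
have D0 : D 0 = 0 by rewrite /D msupp0 big_seq_fset0.
have DU x : D (galg_elt K x) = F x.
  by rewrite (DE [fset x]%fset) ?msuppU_le // big_seq_fset1 mcoeffUU scale1r.
have DMUU x y : D (galg_elt K x * galg_elt K y) =
    D (galg_elt K x) * galg_elt K y + galg_elt K x * D (galg_elt K y).
  rewrite -galg_eltM !DU; apply/malgP => k.
  rewrite mcoeffD mcoeff_mul_elt mcoeff_elt_mul !FE -chiM; last first.
    by rewrite /composable /source /target /= mulgA.
  by rewrite /arrow_comp /= mulVKg.
have DMU x g : D (galg_elt K x * g) = D (galg_elt K x) * g + galg_elt K x * D g.
  elim/galg_linear_ind: g => [|b y g IHg]; first by rewrite !mulr0 D0 mulr0 addr0.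
  rewrite mulrDr -scalerAr !Dlin IHg !mulrDr addrACA -!scalerAr -scalerDr.
  by rewrite DMUU.
have DM f g : D (f * g) = D f * g + f * D g.
  elim/galg_linear_ind: f => [|a x f IHf]; first by rewrite !mul0r D0 mul0r addr0.
  rewrite mulrDl -scalerAl !Dlin IHf !mulrDl addrACA -!scalerAl -scalerDr.
  by rewrite DMU.
have dD : D \in @derivation_pred K (groupAlg K G) by apply/asboolP.
exists (MkDer dD); apply/funext => -[k x].
by rewrite char_ofE [Der_fun _ _]DU FE.
Qed.

(** If [P] holds of a composition exactly when it holds of each factor, the [x]
    over which [chi] vanishes on [P] form a subgroup.  This is how a finite set
    of generators controls the whole character, one coset of arrows at a
    time. *)
Lemma char_eq0_gen chi (P : arrow G -> Prop) (s : seq G) :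
  is_character chi ->
  (forall phi psi, composable phi psi ->
     (P (arrow_comp phi psi) <-> P phi) /\ (P (arrow_comp phi psi) <-> P psi)) ->
  generates s ->
  (forall x u, x \in s -> P (u, x) -> chi (u, x) = 0) ->
  forall phi, P phi -> chi phi = 0.
Proof.
move=> [chiM _] PM sG s0 [u x].
pose H x := `[< forall u, P (u, x) -> chi (u, x) = 0 >].
suff /asboolP : x \in (H : {pred G}) by apply.
move: x {u}; apply: sG => [|x /s0 ?]; last by apply/asboolP.
split=> [|x y /asboolP xH /asboolP yH]; apply/asboolP => u Pu.
  (* [(u, 1)] is an identity arrow, hence idempotent. *)
  have uu : composable (u, 1%g) (u, 1%g).
    by rewrite /composable /source /target /= invg1 mulg1 mul1g.
  have := chiM _ _ uu; rewrite /arrow_comp /= !mul1g => /esym/eqP.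
  by rewrite -subr_eq0 addrK => /eqP.
(* The arrow [phi] over [x / y], after the arrow [psi] over [y], is an arrow
   over [x]; so [chi phi] is a difference of two values already known. *)
set phi := (u, _) in Pu *; pose psi := ((x / y)^-1 * u * y, y)%g.
have pp : composable phi psi.
  by rewrite /composable /source /target /phi /psi /= mulgK.
have ppE : arrow_comp phi psi = (u * y, x)%g.
  by rewrite /arrow_comp /phi /psi /= !mulgA mulgV mul1g mulgVK.
have [Pphi Ppsi] := PM _ _ pp.
have := chiM _ _ pp.
by rewrite (yH _ (Ppsi.1 (Pphi.2 Pu))) ppE xH ?addr0 // -ppE; apply/Pphi.
Qed.

End CharactersAndDerivations.

(** * The decomposition by cosets *)

Section CosetGrading.
Context (K : comNzRingType) (G : groupType) (N : normalSubgroup G).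
Context (GN_abelian : commutative (@monoid.mul (quotg N))).
Implicit Types (d e : Der (groupAlg K G)) (k l : quotg N).
Implicit Types (chi : arrow G -> K) (phi psi : arrow G).

Definition arrow_coset phi : quotg N := cosetg N (source phi).

Lemma cosetgV (x : G) : cosetg N x^-1 = (cosetg N x)^-1%g.
Proof. by apply: (mulgI (cosetg N x)); rewrite -cosetgM !mulgV cosetg1. Qed.

Lemma cosetgJ (x y : G) : cosetg N (x * y * x^-1)%g = cosetg N y.
Proof. by rewrite !cosetgM cosetgV GN_abelian mulKg. Qed.

Lemma arrow_coset_target phi : arrow_coset phi = cosetg N (target phi).
Proof. by rewrite /arrow_coset /source /target !cosetgM GN_abelian. Qed.

Lemma arrow_coset_comp phi psi : composable phi psi ->
  arrow_coset (arrow_comp phi psi) = arrow_coset psi /\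
  arrow_coset phi = arrow_coset psi.
Proof.
move=> pp; split; last by rewrite [RHS]arrow_coset_target -pp.
by rewrite /arrow_coset source_comp.
Qed.

(** Conjugation does not change the coset, [G/N] being abelian, so membership in
    the subgroupoid of a coset is a condition on the source alone. *)
Lemma coset_arrowsE k phi : coset_arrows k phi <-> arrow_coset phi = k.
Proof.
split=> [[a /= <-] [[x _ sE] _]|phik]; first by rewrite /arrow_coset -sE cosetgJ.
exists (source phi) => //; split; first by exists 1%g; rewrite ?mul1g ?invg1 ?mulg1.
by exists phi.2 => //; rewrite /source /target mulVKg.
Qed.

Lemma Der_cosetP k d :
  Der_coset k d <-> forall phi, arrow_coset phi <> k -> char_of d phi = 0.
Proof.
split=> [dk phi phik|dk phi].
  by apply: contra_notP phik => /eqP/dk/coset_arrowsE.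
by move=> /= dphi; apply/coset_arrowsE; apply: contraNP dphi => /dk ->.
Qed.

Lemma Der_coset_subspace k : is_subspace (Der_coset k : set (Der (groupAlg K G))).
Proof.
split=> [|a d e /Der_cosetP dk /Der_cosetP ek].
  by apply/Der_cosetP => phi _; rewrite char_of0.
by apply/Der_cosetP => phi ?; rewrite char_of_linear dk // ek // mulr0 addr0.
Qed.

Lemma restrict_character chi k : is_character chi ->
  is_character (fun phi => if arrow_coset phi == k then chi phi else 0).
Proof.
move=> [chiM chif]; split=> [phi psi pp|y].
  have [-> ->] := arrow_coset_comp pp; rewrite chiM //.
  by case: ifP => // _; rewrite addr0.
by apply: sub_finite_set (chif y) => x /=; case: ifP; rewrite ?eqxx.
Qed.

(** Components are chosen for all degrees at once, to be assembled later into a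
    finitely supported family. *)
Lemma coset_component_exists d : exists c : quotg N -> Der (groupAlg K G),
  forall k phi, char_of (c k) phi = if arrow_coset phi == k then char_of d phi else 0.
Proof.
have H k : exists e, forall phi,
    char_of e phi = if arrow_coset phi == k then char_of d phi else 0.
  have [e eE] := derivation_of_character (restrict_character k (char_ofP d).1).
  by exists e => phi; rewrite eE.
by have [c cE] := choice H; exists c.
Qed.

Lemma char_of_finite_cosets d : finitely_generated G ->
  exists D : {fset quotg N}, forall phi, arrow_coset phi \notin D -> char_of d phi = 0.
Proof.
move=> [s sG].
exists [fset k in flatten [seq [seq arrow_coset (u, x) |
   u <- (msupp (d (galg_elt K x)) : seq G)] | x <- s]]%fset.
apply: char_eq0_gen (char_ofP d).1 _ sG _ => [phi psi /arrow_coset_comp[-> ->]//|].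
move=> x u xs uD; rewrite char_ofE; apply: mcoeff_outdom.
apply: contraNN uD => ud; rewrite inE /=.
by apply/flatten_mapP; exists x => //; apply/mapP; exists u.
Qed.

(** The sum of any family of homogeneous derivations has, at an arrow, the value
    of the single member whose degree is the coset of that arrow.  Hence the
    components found above do sum to [d], and no other family does. *)
Lemma Der_coset_direct_sum : finitely_generated G ->
  is_direct_sum (fun k => Der_coset k : set (Der (groupAlg K G))).
Proof.
move=> G_fg d; have [c cE] := coset_component_exists d.
have [D D0] := char_of_finite_cosets d G_fg.
have sumE (f : {fsfun quotg N -> Der (groupAlg K G) with 0}) phi :
    (forall k, Der_coset k (f k)) ->
    char_of (\sum_(k <- finsupp f) f k) phi = char_of (f (arrow_coset phi)) phi.
  move=> fk; rewrite char_of_sum; set k0 := arrow_coset phi.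
  have f0 k : k != k0 -> char_of (f k) phi = 0.
    by move/eqP=> kk0; apply: (Der_cosetP _ _).1 (fk k) _ _ => /esym.
  case: (finsuppP f k0) => [k0f|k0f]; last first.
    rewrite (big_fsetD1 k0) //= big1_fset ?addr0 // => k.
    by rewrite in_fsetD1 => /andP[/f0].
  rewrite char_of0 big1_seq // => k /= kf; apply: f0.
  by apply: contraNneq k0f => <-.
pose f := [fsfun k in D => c k | 0] : {fsfun quotg N -> Der (groupAlg K G) with 0}.
have fE k : f k = c k.
  rewrite fsfunE; case: ifPn => // kD; apply/esym/char_of_inj => phi.
  by rewrite cE char_of0; case: eqP => // E; apply: D0; rewrite E.
have fk k : Der_coset k (f k).
  by apply/Der_cosetP => phi /eqP/negPf phik; rewrite fE cE phik.
exists f; split; first split=> //.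
  by apply: char_of_inj => phi; rewrite sumE // fE cE eqxx.
move=> g [gk dE]; apply/fsfunP => k; rewrite fE; apply: char_of_inj => phi.
rewrite cE dE sumE //; case: eqP => [->//|phik].
by apply/esym; apply: (Der_cosetP _ _).1 (gk k) _ _.
Qed.

Lemma coef_Der d (f : groupAlg K G) u :
  (d f)@_u = \sum_(x <- msupp f) f@_x * char_of d (u, x).
Proof.
transitivity (\sum_(x <- msupp f) (f@_x *: d (galg_elt K x))@_u).
  rewrite -raddf_sum; congr (mcoeff _ _).
  rewrite {1}[f]monalgE; elim/big_rec2: _ => [|x g h _ <-]; first exact: Der0E.
  by rewrite -Der_linearP galg_scaleU mulr1.
by apply: eq_bigr => x _; rewrite mcoeffZ char_ofE.
Qed.

(** Each term of the coefficient goes from [x] to [u] through some [v], and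
    cosets multiply along this path: [x^-1 u] is the product of [x^-1 v] and
    [v^-1 u]. *)
Lemma Der_coset_comp_coef k l d e u x : Der_coset k d -> Der_coset l e ->
  arrow_coset (u, x) <> (k * l)%g -> (d (e (galg_elt K x)))@_u = 0.
Proof.
move=> /Der_cosetP dk /Der_cosetP el ukl; rewrite coef_Der big1_seq // => v _.
rewrite -char_ofE.
have [vxl|/el ->] := pselect (arrow_coset (v, x) = l); last by rewrite mul0r.
rewrite dk ?mulr0 // => uvk; apply: ukl; rewrite -uvk -vxl /arrow_coset /source /=.
by rewrite GN_abelian -cosetgM /= -mulgA mulVKg.
Qed.

Lemma Der_coset_lie k l d e : Der_coset k d -> Der_coset l e ->
  Der_coset (k * l)%g (lie d e).
Proof.
move=> dk el; apply/Der_cosetP => -[u x] uxkl.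
rewrite char_ofE Der_lieE mcoeffB (Der_coset_comp_coef dk el uxkl).
by rewrite (Der_coset_comp_coef el dk) ?subrr // GN_abelian.
Qed.

End CosetGrading.

(** * Additive functions on finitely generated abelian groups *)

Section AdditiveFunctions.
Context (K : numFieldType) (G : groupType).
Context (GC : commutative (@monoid.mul G)).

(** An additive function on a subgroup of [G] is handled through its graph, a
    subgroup of the product of [G] with the additive group of [K], so that
    extending the function is enlarging the graph and no function on a
    subgroup has to be redefined. *)
Definition additive_graph (P : G -> K -> Prop) : Prop :=
  [/\ P 1%g 0,
      forall x y a b, P x a -> P y b -> P (x / y)%g (a - b)
    & forall a, P 1%g a -> a = 0].

Lemma additive_graphM P x y a b : additive_graph P ->
  P x a -> P y b -> P (x * y)%g (a + b).
Proof.
move=> [P1 PF _] Px Py; rewrite -[y]invgK -[b]opprK; apply: (PF) => //.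
by rewrite -[(y^-1)%g]mul1g -[- b]add0r; apply: PF.
Qed.

Lemma additive_graph_fun P x a b : additive_graph P -> P x a -> P x b -> a = b.
Proof.
move=> [_ PF P0] Pa Pb; apply/eqP; rewrite -subr_eq0; apply/eqP.
by apply: P0; rewrite -[1%g](mulgV x); apply: PF.
Qed.

Lemma additive_graphX P x a n : additive_graph P ->
  P x a -> P (x ^+ n)%g (a *+ n).
Proof.
move=> Pg Px; elim: n => [|n IHn]; first by case: Pg.
by rewrite expgS mulrS; apply: additive_graphM.
Qed.

Let mulgACA : interchange (@monoid.mul G) (@monoid.mul G).
Proof.
move=> x y z t; rewrite -!mulgA; congr (_ * _)%g.
by rewrite !mulgA [(y * z)%g]GC.
Qed.

Let invMg (x y : G) : (x * y)^-1%g = (x^-1 * y^-1)%g.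
Proof. by rewrite invgM GC. Qed.

(** Imposing the value [c] at [g] is consistent as soon as it agrees with the
    powers of [g] already in the domain.  Taking the domain to be trivial
    and [c] nonzero starts the construction at an element of infinite order. *)
Lemma adjoin_additive_graph P g c : additive_graph P ->
  (forall n a, P (g ^+ n)%g a -> a = c *+ n) ->
  exists Q, [/\ additive_graph Q, forall x a, P x a -> Q x a & Q g c].
Proof.
move=> Pg gc; have [P1 PF P0] := Pg.
have PV x a : P x a -> P x^-1%g (- a).
  by move=> Px; rewrite -[(x^-1)%g]mul1g -[- a]add0r; apply: PF.
(* [Q] is the sum of [P] and the line through [(g, c)]; integer powers of [g]
   appear as differences of natural ones. *)
pose Q x a := exists m n, P (x * (g ^+ m / g ^+ n))%g (a + (c *+ m - c *+ n)).
exists Q; split; first split.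
- by exists 0%N, 0%N; rewrite mul1g !expg0 mulgV mulr0n subrr addr0.
- move=> x y a b [m [n Px]] [m' [n' Py]]; exists (m + n')%N, (n + m')%N.
  have := PF _ _ _ _ Px Py; congr (P _ _); last by ring.
  rewrite invMg mulgACA; congr (_ * _)%g.
  by rewrite invgF mulgACA -invMg -!expgnDr.
- move=> a [m [n]]; rewrite mul1g => Pa; apply/eqP; have [mn|/ltnW mn] := leqP n m.
    move: Pa; rewrite -expgnFr // -mulrnBr // => /gc /eqP.
    by rewrite -subr_eq0 addrK.
  move: Pa => /PV; rewrite invgF -expgnFr // opprD opprB -mulrnBr // => /gc /eqP.
  by rewrite -subr_eq0 addrK oppr_eq0.
- by move=> x a Px; exists 0%N, 0%N; rewrite !expg0 mulgV mulg1 mulr0n subrr addr0.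
by exists 0%N, 1%N; rewrite expg0 expg1 mul1g mulgV mulr0n sub0r subrr.
Qed.

(** If some power [g ^+ n] is already in the domain, characteristic zero lets one
    divide its value by [n]; otherwise any value at [g] will do. *)
Lemma extend_additive_graph P g : additive_graph P ->
  exists Q, [/\ additive_graph Q, forall x a, P x a -> Q x a & exists c, Q g c].
Proof.
move=> Pg.
suff [c gc] : exists c, forall n a, P (g ^+ n)%g a -> a = c *+ n.
  by have [Q [? ? ?]] := adjoin_additive_graph Pg gc; exists Q; split=> //; exists c.
have [[n [a [n_gt0 Pa]]]|noP] :=
  pselect (exists n a, (0 < n)%N /\ P (g ^+ n)%g a); last first.
  exists 0 => n a Pna; rewrite mul0rn; case: n => [|n] in Pna *.
    by case: Pg => _ _; apply.
  by case: noP; exists n.+1, a.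
exists (a / n%:R) => m b Pb.
have n_neq0 : n%:R != 0 :> K by rewrite pnatr_eq0 -lt0n.
apply: (mulIf n_neq0); rewrite mulrnAl divfK // mulr_natr.
have := additive_graphX m Pg Pa; rewrite expgnAC.
exact: (additive_graph_fun Pg (additive_graphX n Pg Pb)).
Qed.

(** Start from [h g = 1] on the cyclic group of [g] and extend over the
    generators one at a time. *)
Lemma nonzero_additive_of_infinite_order (s : seq G) (g : G) :
  generates s ->
  (forall n, (g ^+ n)%g = 1%g -> n = 0%N) ->
  exists h : G -> K, (forall x y, h (x * y)%g = h x + h y) /\ h g <> 0.
Proof.
move=> sG g_inf.
have [P [Pg _ gP]] : exists Q, [/\ additive_graph Q,
    forall x a, (x = 1%g /\ a = 0) -> Q x a & Q g 1].
  apply: adjoin_additive_graph => [|n a [/g_inf -> ->]]; last by rewrite mulr0n.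
  by split=> [//|x y a b [-> ->] [-> ->]|a []//]; rewrite mulgV subrr.
have [Q [Qg PQ sQ]] : exists Q, [/\ additive_graph Q, forall x a, P x a -> Q x a
    & {in s, forall x, exists c, Q x c}].
  elim: s {sG} => [|x s [Q [Qg PQ sQ]]]; first by exists P.
  have [Q' [Q'g QQ' xQ']] := extend_additive_graph x Qg; exists Q'.
  split=> // [y a /PQ/QQ'//|y]; rewrite inE => /predU1P[->//|/sQ[c Qy]].
  by exists c; apply: QQ'.
have allQ x : exists c, Q x c.
  apply/asboolP; move: x; apply: (sG (fun x => `[< exists c, Q x c >])).
    split=> [|x y /asboolP[a Qx] /asboolP[b Qy]]; apply/asboolP.
      by exists 0; case: Qg.
    by exists (a - b); case: Qg => _ QF _; apply: QF.
  by move=> x /sQ xQ; apply/asboolP.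
have [h hQ] := choice allQ; exists h; split=> [x y|].
  exact: additive_graph_fun Qg (hQ _) (additive_graphM Qg (hQ x) (hQ y)).
rewrite -(additive_graph_fun Qg (PQ _ _ gP) (hQ g)); exact/eqP/oner_neq0.
Qed.

End AdditiveFunctions.

Section TorsionAbelian.
Context (G : groupType).
Context (GC : commutative (@monoid.mul G)).

(** Adding a generator [g] of order dividing [n] to a finite subgroup [X] gives
    at most [n] translates of [X]. *)
Lemma abelian_fg_torsion_finite : finitely_generated G ->
  (forall g : G, exists2 n, (0 < n)%N & (g ^+ n)%g = 1%g) -> finite_set [set: G].
Proof.
move=> [s sG] tor.
suff [X XG sX] : exists2 X : set G, finite_set X &
    group_closed (fun x => `[< X x >]) /\ {in s, forall x, X x}.
  apply: sub_finite_set XG => x _; apply/asboolP.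
  by apply: (sG (fun x => `[< X x >])) x => [|x /sX.2 Xx]; [case: sX | apply/asboolP].
elim: s {sG} => [|g s [X Xfin [[/asboolP X1 XF] sX]]].
  exists [set 1%g]; first exact: finite_set1.
  split=> //; split=> [|x y /asboolP -> /asboolP ->]; apply/asboolP => //.
  by rewrite mulgV.
have {}XF x y : X x -> X y -> X (x / y)%g.
  by move=> Xx Xy; apply/asboolP; apply: XF; apply/asboolP.
have [n n_gt0 gn1] := tor g.
have gmod m : (g ^+ m = g ^+ (m %% n))%g.
  by rewrite {1}(divn_eq m n) expgnDr mulnC expgnA gn1 expg1n mul1g.
exists ((fun p => p.1 * g ^+ p.2)%g @` (X `*` `I_n)).
  by apply: finite_image; apply: finite_setX => //; exact: finite_II.
split; first split.
- by apply/asboolP; exists (1%g, 0%N) => //=; rewrite expg0 mulg1.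
- move=> _ _ /asboolP[[x i] [/= Xx i_n] <-] /asboolP[[y j] [/= Xy j_n] <-].
  apply/asboolP; exists ((x / y)%g, (i + (n - j)) %% n)%N => /=.
    by split; [apply: XF | rewrite ltn_mod].
  rewrite -(gmod (i + (n - j))%N) expgnDr (expgnFr g (ltnW j_n)) gn1.
  rewrite mul1g invgM -!mulgA; congr (_ * _)%g.
  by rewrite [LHS]GC -!mulgA.
- move=> x; rewrite inE => /predU1P[->|/sX Xx].
    exists (1%g, 1 %% n)%N; first by split; rewrite //= ltn_mod.
    by rewrite /= mul1g -(gmod 1%N) expg1.
  by exists (x, 0%N) => //=; rewrite expg0 mulg1.
Qed.

End TorsionAbelian.

(** * Derivations outside the neutral component *)

Section NontrivialCharacters.
Context (K : numFieldType) (G : groupType) (N : normalSubgroup G).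

(** This is the character of the inner derivation of [a]: the coboundary of the
    indicator function of the object [a]. *)
Lemma inner_character (a : G) : is_character
  (fun phi => (target phi == a)%:R - (source phi == a)%:R : K).
Proof.
split=> [phi psi pp|y].
  by rewrite source_comp target_comp // -pp subrKA.
apply: (@sub_finite_set _ _ [set` [:: (a * y)%g; (y * a)%g]]); last first.
  exact: finite_seq.
move=> x /=; rewrite !inE /target /source /=.
case: (x * y^-1 =P a)%g => [<- _|_]; first by rewrite mulgVK eqxx.
case: (y^-1 * x =P a)%g => [<- _|_]; first by rewrite mulVKg eqxx orbT.
by rewrite subrr eqxx.
Qed.

(** In an abelian group every arrow [(z y, y)] is a loop at [z], and composition
    of loops at [z] multiplies the [y]. *)
Lemma loop_character (h : G -> K) (z : G) : commutative (@monoid.mul G) ->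
  {morph h : x y / (x * y)%g >-> x + y} ->
  is_character (fun phi => if target phi == z then h phi.2 else 0).
Proof.
move=> GC hM; split=> [phi psi pp|y].
  have -> : target psi = target phi by rewrite -pp /source /target GC.
  by rewrite target_comp // hM; case: ifP => // _; rewrite addr0.
apply: sub_finite_set (finite_set1 (z * y)%g) => x /=.
rewrite /target /=; case: (x * y^-1 =P z)%g => [<- _|_]; last by rewrite eqxx.
by rewrite mulgVK.
Qed.

(** If the complement of [N] were central, then for [x] in [N] and [z] outside,
    both [z] and [z x] would be central, hence so would [x]. *)
Lemma commutative_of_central_complement (z : G) : cosetg N z <> 1%g ->
  (forall a, cosetg N a <> 1%g -> forall x, (a * x = x * a)%g) ->
  commutative (@monoid.mul G).
Proof.
move=> zN cen x y; have [xN|/cen->//] := pselect (cosetg N x = 1%g).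
have zxN : cosetg N (z * x)%g <> 1%g by rewrite cosetgM xN mulg1.
apply: (mulgI z); rewrite mulgA (cen _ zxN) mulgA (cen _ zN) -!mulgA.
by rewrite (cen _ zN).
Qed.

Lemma exists_character_off_N :
  infinite_set [set: G] -> finitely_generated G ->
  commutative (@monoid.mul (quotg N)) -> (exists k l : quotg N, k <> l) ->
  exists (chi : arrow G -> K) phi,
    [/\ is_character chi, chi phi <> 0 & arrow_coset N phi <> 1%g].
Proof.
move=> G_inf G_fg GN_abelian [k [l kl]].
have [z zN] : exists z, cosetg N z <> 1%g.
  apply: contrapT => noz; have allN x : cosetg N x = 1%g.
    by apply: contrapT => xN; apply: noz; exists x.
  by apply: kl; rewrite -(cosetgK k) -(cosetgK l) !allN.
have [[a [x [aN ax]]]|cen] :=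
  pselect (exists a x, cosetg N a <> 1%g /\ (a * x <> x * a)%g).
  exists (fun phi => (target phi == a)%:R - (source phi == a)%:R), (a * x, x)%g.
  split; first exact: inner_character.
    rewrite /target /source /= mulgK eqxx; case: eqP => [sa|_].
      by case: ax; rewrite -[in RHS]sa mulVKg.
    by rewrite subr0; apply/eqP/oner_neq0.
  by rewrite arrow_coset_target // /target /= mulgK.
have GC : commutative (@monoid.mul G).
  apply: (commutative_of_central_complement zN) => a aN x.
  by apply: contrapT => ax; apply: cen; exists a, x.
have [g g_inf] : exists g : G, forall n, (g ^+ n)%g = 1%g -> n = 0%N.
  apply: contrapT => nog; apply: G_inf; apply: abelian_fg_torsion_finite => // g.
  apply: contrapT => g_inf; apply: nog; exists g => -[//|n] gn1.
  by case: g_inf; exists n.+1.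
have [s sG] := G_fg.
have [h [hM hg]] := nonzero_additive_of_infinite_order K GC sG g_inf.
exists (fun phi => if target phi == z then h phi.2 else 0), (z * g, g)%g.
split; first exact: loop_character.
  by rewrite /target /= mulgK eqxx.
by rewrite arrow_coset_target // /target /= mulgK.
Qed.

End NontrivialCharacters.

Theorem theorem1 (R : realType) (G : groupType) (N : normalSubgroup G)
    (G_infinite : infinite_set [set: G])
    (G_fg : finitely_generated G)
    (GN_abelian : commutative (@monoid.mul (quotg N)))
    (GN_gt1 : exists k l : quotg N, k <> l) :
  @graded R[i] (Der (groupAlg R[i] G)) (quotg N)
    (fun k : quotg N => Der_coset k).
Proof.
split=> //.
- exact: Der_coset_subspace.
- exact: Der_coset_direct_sum.
- by move=> k l d e; apply: Der_coset_lie.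
have [chi [phi [chi_char chi_phi phiN]]] :=
  exists_character_off_N R[i] G_infinite G_fg GN_abelian GN_gt1.
have [d dE] := derivation_of_character chi_char.
by case/seteqP => _ /(_ d I)/(Der_cosetP GN_abelian)/(_ _ phiN); rewrite dE.
Qed.
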